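(* For every alphabet $\Sigma$, the classes $\mathcal{G}_{\mathrm{bnd},\Sigma}$, $\mathcal{G}_{\mathrm{pbnd},\Sigma}$, $\mathcal{G}_{\mathrm{lin},\Sigma}$, $\mathcal{G}_{\mathrm{plin},\Sigma}$, $\mathcal{G}_{\mathrm{bnd}}$, $\mathcal{G}_{\mathrm{pbnd}}$, $\mathcal{G}_{\mathrm{lin}}$, $\mathcal{G}_{\mathrm{plin}}$ all coincide (as classes of groups up to isomorphism).
   Context: An alphabet is a finite set with at least two elements. For the full shift $\Sigma^{\mathbb{Z}}$ with shift $\sigma(x)_i=x_{i+1}$, $\llbracket\Sigma^{\mathbb{Z}}\rrbracket$ is the group of homeomorphisms $f$ with a continuous cocycle $c:\Sigma^{\mathbb{Z}}\to\mathbb{Z}$ such that $f(x)=\sigma^{c(x)}(x)$. Write $[w]_i=\{x:x_{[i,i+|w|-1]}=w\}$. A subgroup $G\le\llbracket\Sigma^{\mathbb{Z}}\rrbracket$ has look-ahead $\alpha:\mathbb{N}\to\mathbb{N}$ if $\alpha(0)=0$ and for every non-identity $g\in G$ with cocycle $c$ there exist $n\ge1$, $w\in\Sigma^{2n+1}$ and $m\in\mathbb{Z}$ with $c(x)=m$ for all $x\in[w]_{-n}$ and $|m|+\alpha(|m|)\ge n$; it has plook-ahead $\alpha$ if $\alpha(0)=0$ and for every non-identity $g\in G$ with cocycle $c$ there are $n\ge1$ and a point $x$ with $\sigma^p(x)=x$ for some $1\le p\le 2n+1$ and $|c(x)|+\alpha(|c(x)|)\ge n$. $\alpha$ is linear if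 there is $C\in\mathbb{N}$ with $\alpha(n)\le Cn+C$ for all $n$, and bounded if it is a bounded function. $\mathcal{G}_{\mathrm{bnd},\Sigma}$ (resp. $\mathcal{G}_{\mathrm{lin},\Sigma}$, $\mathcal{G}_{\mathrm{pbnd},\Sigma}$, $\mathcal{G}_{\mathrm{plin},\Sigma}$) is the class of groups isomorphic to a subgroup of $\llbracket\Sigma^{\mathbb{Z}}\rrbracket$ having some bounded look-ahead (resp. linear look-ahead, bounded plook-ahead, linear plook-ahead). The classes without subscript $\Sigma$ are the unions over all alphabets $\Sigma$. *)

(* Defs.v *)
From Stdlib Require Import ZArith.
From mathcomp Require Import all_boot.

Set Implicit Arguments.
Unset Strict Implicit.
Unset Printing Implicit Defensive.

Record group := Group {
  gcar :> Type;
  gmul : gcar -> gcar -> gcar;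
  gone : gcar;
  ginv : gcar -> gcar;
  gmulA : forall a b c, gmul a (gmul b c) = gmul (gmul a b) c;
  gmul1g : forall a, gmul gone a = a;
  gmulVg : forall a, gmul (ginv a) a = gone
}.

Definition conf (S : finType) := Z -> S.

Definition shift (S : finType) (m : Z) (x : conf S) : conf S :=
  fun i => x (i + m)%Z.

Definition agree (S : finType) (n : nat) (x y : conf S) : Prop :=
  forall i : Z, (- Z.of_nat n <= i <= Z.of_nat n)%Z -> x i = y i.

(* continuity for the product topology on Sigma^Z (cylinder basis) *)
Definition cont_map (S : finType) (f : conf S -> conf S) : Prop :=
  forall (x : conf S) (m : nat), exists n : nat,
    forall y, agree n x y -> agree m (f x) (f y).

(* continuity into the discrete space Z *)
Definition cont_cocycle (S : finType) (c : conf S -> Z) : Prop :=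
  forall x : conf S, exists n : nat, forall y, agree n x y -> c y = c x.

Definition homeo (S : finType) (f : conf S -> conf S) : Prop :=
  exists g : conf S -> conf S,
    g \o f = id /\ f \o g = id /\ cont_map f /\ cont_map g.

Definition is_cocycle (S : finType) (f : conf S -> conf S) (c : conf S -> Z) :=
  cont_cocycle c /\ forall x, f x = shift (c x) x.

Definition in_tfg (S : finType) (f : conf S -> conf S) : Prop :=
  homeo f /\ exists c, is_cocycle f c.

Definition tfg_subgroup (S : finType) (H : (conf S -> conf S) -> Prop) :=
  [/\ forall f, H f -> in_tfg f,
      H id,
      forall f g, H f -> H g -> H (f \o g)
    & forall f, H f -> exists g, [/\ H g, g \o f = id & f \o g = id]].

Definition cyl (S : finType) (k : nat) (i : Z) (w : k.-tuple S) (x : conf S) :=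
  forall j : 'I_k, x (i + Z.of_nat j)%Z = tnth w j.

Definition lookahead (S : finType) (H : (conf S -> conf S) -> Prop)
    (alpha : nat -> nat) : Prop :=
  alpha 0 = 0 /\
  forall g, H g -> g <> id -> forall c, is_cocycle g c ->
    exists (n : nat) (w : (2 * n + 1).-tuple S) (m : Z),
      1 <= n /\
      (forall x, cyl (- Z.of_nat n)%Z w x -> c x = m) /\
      n <= Z.abs_nat m + alpha (Z.abs_nat m).

Definition plookahead (S : finType) (H : (conf S -> conf S) -> Prop)
    (alpha : nat -> nat) : Prop :=
  alpha 0 = 0 /\
  forall g, H g -> g <> id -> forall c, is_cocycle g c ->
    exists (n : nat) (x : conf S) (p : nat),
      [/\ 1 <= n, 1 <= p <= 2 * n + 1, shift (Z.of_nat p) x = x &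
          n <= Z.abs_nat (c x) + alpha (Z.abs_nat (c x))].

Definition linear_fn (alpha : nat -> nat) : Prop :=
  exists C : nat, forall n, alpha n <= C * n + C.

Definition bounded_fn (alpha : nat -> nat) : Prop :=
  exists B : nat, forall n, alpha n <= B.

Definition iso_to (S : finType) (G : group) (H : (conf S -> conf S) -> Prop) :=
  exists phi : G -> conf S -> conf S,
    [/\ forall a b, phi (gmul a b) = phi a \o phi b,
        injective phi
      & forall f, H f <-> exists a, phi a = f].

Definition GClass (S : finType)
    (LA : ((conf S -> conf S) -> Prop) -> (nat -> nat) -> Prop)
    (Growth : (nat -> nat) -> Prop) (G : group) : Prop :=
  exists H, [/\ tfg_subgroup H, iso_to G H & exists alpha, Growth alpha /\ LA H alpha].

Definition G_bnd  (S : finType) := GClass (@lookahead S) bounded_fn.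
Definition G_lin  (S : finType) := GClass (@lookahead S) linear_fn.
Definition G_pbnd (S : finType) := GClass (@plookahead S) bounded_fn.
Definition G_plin (S : finType) := GClass (@plookahead S) linear_fn.

Definition G_bnd_all  (G : group) := exists S : finType, 1 < #|S| /\ G_bnd S G.
Definition G_lin_all  (G : group) := exists S : finType, 1 < #|S| /\ G_lin S G.
Definition G_pbnd_all (G : group) := exists S : finType, 1 < #|S| /\ G_pbnd S G.
Definition G_plin_all (G : group) := exists S : finType, 1 < #|S| /\ G_plin S G.

(* Main.v *)
(** All eight classes lie in G_plin over some alphabet T, so it suffices to embed a group H of the full group of T^Z with linear plookahead into the full group of S^Z with bounded look-ahead.  For any tau in the full group of S^Z and any continuous letter map S^Z -> T, reading letters along tau-orbits gives pi : S^Z -> T^Z with pi o tau = sigma o pi, and g with cocycle c acts on S^Z by y |-> tau^(c (pi y)) y; this is a homomorphism.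

The element tau chosen here moves the origin along conveyor belts.  Non-overlapping codewords encode cells; a maximal run of cells forms a belt that goes right through the top letters, one per cell, and comes back left through the bottom letters, between 1 and a constant number per cell.  Linear plookahead gives for each nontrivial g a point z of period p = O(|c|), where c is the cocycle of g at z.  A belt with |c| + 1 cells whose total length is a multiple of p can carry z, and c steps along it go from one end to the other, so the displacement misses the size of the window determining it only by a constant. *)

From Stdlib Require Import ZArith Lia FunctionalExtensionality ClassicalEpsilon.
From mathcomp Require Import all_boot zify.
Require Import Defs.

Set Implicit Arguments.
Unset Strict Implicit.
Unset Printing Implicit Defensive.

Local Open Scope Z_scope.

(** * Shifts, cocycles and their composition *)

Lemma shiftD (S : finType) (a b : Z) (x : conf S) :
  shift a (shift b x) = shift (b + a) x.
Proof. by apply: functional_extensionality => i; rewrite /shift; congr (x _); lia. Qed.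

Lemma shift0 (S : finType) (x : conf S) : shift 0 x = x.
Proof. by apply: functional_extensionality => i; rewrite /shift; congr (x _); lia. Qed.

Lemma agreeW (S : finType) (m n : nat) (x y : conf S) :
  (m <= n)%N -> agree n x y -> agree m x y.
Proof. by move=> mn xy i im; apply: xy; lia. Qed.

Lemma agree_sym (S : finType) (n : nat) (x y : conf S) : agree n x y -> agree n y x.
Proof. by move=> xy i im; rewrite xy. Qed.

Lemma agree_shift (S : finType) (m n : nat) (u : Z) (x y : conf S) :
  Z.of_nat m + Z.abs u <= Z.of_nat n -> agree n x y -> agree m (shift u x) (shift u y).
Proof. by move=> mn xy i im; apply: xy; lia. Qed.

Lemma cocycle_cont_map (S : finType) (f : conf S -> conf S) (c : conf S -> Z) :
  is_cocycle f c -> cont_map f.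
Proof.
move=> [cc fE] x m; have [n cn] := cc x.
exists (maxn n (m + Z.abs_nat (c x))) => y xy; rewrite !fE (cn y); last by apply: agreeW xy; lia.
by apply: agree_shift xy; lia.
Qed.

Lemma cocycle_comp (S : finType) (f g : conf S -> conf S) (c e : conf S -> Z) :
  is_cocycle f c -> is_cocycle g e -> is_cocycle (f \o g) (fun x => c (g x) + e x).
Proof.
move=> fc ge; split=> [x|x]; last by rewrite /= fc.2 {2}ge.2 shiftD Z.add_comm.
have [n1 h1] := fc.1 (g x); have [n2 h2] := cocycle_cont_map ge x n1; have [n3 h3] := ge.1 x.
exists (maxn n2 n3) => y xy; rewrite h1 ?h3 //; first by apply: agreeW xy; lia.
by apply: h2; apply: agreeW xy; lia.
Qed.

Lemma cocycle_id (S : finType) : is_cocycle (@id (conf S)) (fun=> 0).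
Proof. by split=> x; [exists 0%N | rewrite shift0]. Qed.

Lemma shift_periodN (S : finType) (d : Z) (x : conf S) (n : nat) (i : Z) :
  shift d x = x -> x (i + Z.of_nat n * d) = x i.
Proof.
move=> xd; elim: n => [|n IH]; first by congr (x _); lia.
by rewrite -[RHS]IH -[in RHS]xd /shift; congr (x _); lia.
Qed.

Lemma shift_periodZ (S : finType) (d : Z) (x : conf S) (n i : Z) :
  shift d x = x -> x (i + n * d) = x i.
Proof.
move=> xd; case: (Z_le_gt_dec 0 n) => h.
  by have := shift_periodN (Z.to_nat n) i xd; rewrite Z2Nat.id.
have := shift_periodN (Z.to_nat (- n)) (i + n * d) xd; rewrite Z2Nat.id; last lia.
by move=> <-; congr (x _); lia.
Qed.

Lemma two_letters (S : finType) : (1 < #|S|)%N -> exists a b : S, a <> b.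
Proof.
move=> hS; exists (enum_val (Ordinal (ltnW hS))), (enum_val (Ordinal hS)).
by move/enum_val_inj/(congr1 val).
Qed.

(* A configuration asymptotic to distinct constants at both ends is aperiodic, and such configurations are dense. *)
Lemma cocycle_uniq (S : finType) (f : conf S -> conf S) (c e : conf S -> Z) :
  (1 < #|S|)%N -> is_cocycle f c -> is_cocycle f e -> c = e.
Proof.
move=> /two_letters [a [b ab]] fc fe; apply: functional_extensionality => x.
have [n1 h1] := fc.1 x; have [n2 h2] := fe.1 x; pose n := maxn n1 n2.
pose y : conf S := fun i => if i <? - Z.of_nat n then a else if i <=? Z.of_nat n then x i else b.
have xy : agree n x y by move=> i hi; rewrite /y; case: Z.ltb_spec => ?; [lia | case: Z.leb_spec => ?; [by [] | lia]].
have cy : c y = c x by apply: h1; apply: agreeW xy; lia.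
have ey : e y = e x by apply: h2; apply: agreeW xy; lia.
have per : shift (c x - e x) y = y.
  have /(congr1 (shift (- e x))) : shift (c x) y = shift (e x) y by rewrite -cy -ey -fc.2 -fe.2.
  by rewrite !shiftD Z.add_opp_diag_r shift0.
case: (Z.eq_dec (c x) (e x)) => // ne; case: ab.
pose N := 2 * Z.of_nat n + 2; pose d := c x - e x.
have := shift_periodZ (N * Z.sgn d) (- Z.of_nat n - 1) per.
rewrite -/d /y; have -> : N * Z.sgn d * d = N * Z.abs d by rewrite -(Z.sgn_abs d); lia.
have h : N <= N * Z.abs d by rewrite /N; nia.
do 2![case: Z.ltb_spec => ?; [|case: Z.leb_spec => ?]] => //; lia.
Qed.

(** * Simulation along the orbits of a full-group element *)

Section Orbits.
Variables (S T : finType) (d d' : conf S -> Z) (lam : conf S -> T).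

Fixpoint walk_nat (e : conf S -> Z) (n : nat) (y : conf S) : Z :=
  if n is n'.+1 then e y + walk_nat e n' (shift (e y) y) else 0.

(** With [tau y = shift (d y) y] and [d'] the displacement of the inverse of tau, this is the
    displacement of [tau^m] at [y], for [m] of either sign. *)
Definition walk (m : Z) (y : conf S) : Z :=
  match m with
  | Z0 => 0
  | Zpos p => walk_nat d (Pos.to_nat p) y
  | Zneg p => walk_nat d' (Pos.to_nat p) y
  end.

Definition itinerary (y : conf S) : conf T := fun i => lam (shift (walk i y) y).

Definition sim_cocycle (c : conf T -> Z) (y : conf S) : Z := walk (c (itinerary y)) y.

Definition sim (c : conf T -> Z) (y : conf S) : conf S := shift (sim_cocycle c y) y.

Hypothesis dK : forall y, d' (shift (d y) y) = - d y.
Hypothesis d'K : forall y, d (shift (d' y) y) = - d' y.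

Lemma walk_of_nat n y : walk (Z.of_nat n) y = walk_nat d n y.
Proof. by case: n => [|n] //; rewrite /walk /= SuccNat2Pos.id_succ. Qed.

Lemma walk_opp_of_nat n y : walk (- Z.of_nat n) y = walk_nat d' n y.
Proof. by case: n => [|n] //; rewrite /walk /= SuccNat2Pos.id_succ. Qed.

Lemma walkSl m y : walk (m + 1) y = d y + walk m (shift (d y) y).
Proof.
case: (Z_le_gt_dec 0 m) => h.
  rewrite -(Z2Nat.id m) //.
  have -> : Z.of_nat (Z.to_nat m) + 1 = Z.of_nat (Z.to_nat m).+1 by lia.
  by rewrite !walk_of_nat.
have [n ->] : exists n, m = - Z.of_nat n.+1 by exists (Z.to_nat (- m)).-1; lia.
have -> : - Z.of_nat n.+1 + 1 = - Z.of_nat n by lia.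
by rewrite !walk_opp_of_nat /= dK shiftD Z.add_opp_diag_r shift0; lia.
Qed.

Lemma walkPl m y : walk (m - 1) y = d' y + walk m (shift (d' y) y).
Proof.
have -> : m = (m - 1) + 1 by lia.
rewrite walkSl d'K shiftD Z.add_opp_diag_r shift0.
have -> : m - 1 + 1 - 1 = m - 1 by lia.
lia.
Qed.

Lemma walkD m n y : walk (m + n) y = walk n y + walk m (shift (walk n y) y).
Proof.
elim/Z.peano_ind: n y => [y|n IH y|n IH y]; first by rewrite Z.add_0_r shift0.
  have -> : m + Z.succ n = m + n + 1 by lia.
  by rewrite -(Z.add_1_r n) !walkSl IH shiftD; lia.
have -> : m + Z.pred n = m + n - 1 by lia.
by rewrite -(Z.sub_1_r n) !walkPl IH shiftD; lia.
Qed.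

Lemma itinerary_walk m y : itinerary (shift (walk m y) y) = shift m (itinerary y).
Proof.
by apply: functional_extensionality => i; rewrite /itinerary shiftD -walkD.
Qed.

(** Each step of tau shifts the itinerary by one, so after [sim e] the itinerary has been moved by
    [g]. The two walks then add up by [walkD]. *)
Lemma sim_comp (c e : conf T -> Z) f g : is_cocycle f c -> is_cocycle g e ->
  sim (fun x => c (g x) + e x) = sim c \o sim e.
Proof.
move=> fc ge; apply: functional_extensionality => y.
have E : itinerary (sim e y) = g (itinerary y) by rewrite ge.2 -itinerary_walk.
by rewrite /= [RHS]/sim /sim_cocycle E /sim /sim_cocycle shiftD -walkD.
Qed.

Lemma sim_id : sim (fun=> 0) = id.
Proof. by apply: functional_extensionality => y; rewrite /sim shift0. Qed.

Variable R : nat.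
Hypothesis d_local : forall y y', agree R y y' -> d y = d y'.
Hypothesis d'_local : forall y y', agree R y y' -> d' y = d' y'.
Hypothesis lam_local : forall y y', agree R y y' -> lam y = lam y'.

Lemma walk_nat_cont e n : (forall y y', agree R y y' -> e y = e y') ->
  cont_cocycle (walk_nat e n).
Proof.
move=> eR; elim: n => [|n IH] y; first by exists 0%N.
have [k kP] := IH (shift (e y) y).
exists (maxn R (k + Z.abs_nat (e y))) => z yz /=.
rewrite -(eR y z) ?kP //; last by apply: agreeW yz; lia.
by apply: agree_shift yz; lia.
Qed.

Lemma walk_cont m : cont_cocycle (walk m).
Proof. by case: m => [y|p|p]; [exists 0%N | exact: walk_nat_cont | exact: walk_nat_cont]. Qed.

Lemma itinerary_local (y : conf S) (n : nat) :
  exists m, forall z, agree m y z -> agree n (itinerary y) (itinerary z).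
Proof.
have one i : exists m, forall z, agree m y z -> itinerary z i = itinerary y i.
  have [k kP] := walk_cont i y; exists (maxn k (R + Z.abs_nat (walk i y))) => z yz.
  rewrite /itinerary kP; last by apply: agreeW yz; lia.
  by apply: lam_local; apply/agree_sym/(agree_shift _ yz); lia.
elim: n => [|n [m mP]].
  have [m mP] := one 0; exists m => z yz i hi.
  by rewrite (_ : i = 0) ?mP //; lia.
have [m1 m1P] := one (Z.of_nat n.+1); have [m2 m2P] := one (- Z.of_nat n.+1).
exists (maxn m (maxn m1 m2)) => z yz i hi.
case: (Z.eq_dec i (Z.of_nat n.+1)) => [->|ne1].
  by rewrite m1P //; apply: agreeW yz; lia.
case: (Z.eq_dec i (- Z.of_nat n.+1)) => [->|ne2].
  by rewrite m2P //; apply: agreeW yz; lia.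
by apply: (mP z); [apply: agreeW yz; lia | lia].
Qed.

Lemma sim_is_cocycle c : cont_cocycle c -> is_cocycle (sim c) (sim_cocycle c).
Proof.
move=> cc; split=> // y; have [n nP] := cc (itinerary y).
have [m mP] := itinerary_local y n; have [k kP] := walk_cont (c (itinerary y)) y.
exists (maxn m k) => z yz; rewrite /sim_cocycle (nP (itinerary z)).
  by apply: kP; apply: agreeW yz; lia.
by apply: mP; apply: agreeW yz; lia.
Qed.

End Orbits.

(** * The conveyor belt *)

Section Belt.
Variables (S T : finType) (s1 : S) (t0 : T) (N : nat).

(* A cell carries one letter on its top track (index 0) and, on its bottom track, the letters of indices 1 to n+1, where n is the second component. *)
Definition cell : finType := ({ffun 'I_N.+2 -> T} * 'I_N.+1)%type.

Definition nbot (a : cell) : Z := Z.of_nat a.2.+1.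

(** One-hot words need [#|cell|] places. The extra [N] ensures that the offsets 0 to [N + 1], which
    serve as head positions, fit inside a codeword. *)
Definition nrun : nat := (#|cell| + N)%N.
Definition klen : nat := (2 * nrun + 4)%N.
Local Notation k := (Z.of_nat klen).

(* Codewords are 1^(nrun+2) 0 u 0 with u one-hot of length nrun; the long run of ones prevents two codewords from overlapping. *)
Definition codebit (a : cell) (j : Z) : bool :=
  (j <? Z.of_nat nrun + 2) || (j =? Z.of_nat nrun + 3 + Z.of_nat (enum_rank a)).

Definition cell_at (y : conf S) (i : Z) (a : cell) : bool :=
  [forall j : 'I_klen, (y (i + Z.of_nat j) == s1) == codebit a (Z.of_nat j)].

Definition some_cell (y : conf S) (i : Z) : bool := [exists a, cell_at y i a].

Definition locate (y : conf S) : option ('I_klen * cell) :=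
  [pick x : 'I_klen * cell | cell_at y (- Z.of_nat x.1) x.2].

(** The origin is the head, at offset [o] of the codeword of [a]: offset 0 is the top track, offsets
    1 to [nbot a] are the bottom letters. The head goes right along the top, drops to offset 1 at
    the right end, runs through the bottom letters of a cell and jumps to offset 1 of the left
    neighbour. At the left end it returns to the top. Later offsets are fixed. *)
Definition fwd_at (y : conf S) (o : Z) (a : cell) : Z :=
  if o =? 0 then if some_cell y k then k else 1
  else if o <? nbot a then 1
  else if o =? nbot a then if some_cell y (- o - k) then 1 - o - k else - o
  else 0.

(** Going back from offset 1 leads to the last bottom letter of the right neighbour, hence that cell
    must be decoded to learn its [nbot]. *)
Definition bwd_at (y : conf S) (o : Z) (a : cell) : Z :=
  if o =? 0 then if some_cell y (- k) then - k else nbot a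
  else if o =? 1 then
    if [pick e | cell_at y (k - 1) e] is Some e then k - 1 + nbot e else - 1
  else if o <=? nbot a then - 1
  else 0.

Definition fwd (y : conf S) : Z :=
  if locate y is Some x then fwd_at y (Z.of_nat x.1) x.2 else 0.

Definition bwd (y : conf S) : Z :=
  if locate y is Some x then bwd_at y (Z.of_nat x.1) x.2 else 0.

Definition letter (y : conf S) : T :=
  if locate y is Some x then x.2.1 (inord x.1) else t0.

(** * Unique decoding of codewords *)

Lemma cell_atP y i a :
  reflect (forall j, 0 <= j < k -> (y (i + j) == s1) = codebit a j) (cell_at y i a).
Proof.
apply: (iffP forallP) => [h j hj|h j]; last by apply/eqP/h; have := ltn_ord j; lia.
have hj' : (Z.to_nat j < klen)%N by lia.
have /eqP := h (Ordinal hj'); have -> // : Z.of_nat (Ordinal hj') = j.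
by rewrite /= Z2Nat.id; lia.
Qed.

Lemma cell_at_shift u y i a : cell_at (shift u y) i a = cell_at y (i + u) a.
Proof.
apply: eq_forallb => j; rewrite /shift.
by have -> : i + Z.of_nat j + u = i + u + Z.of_nat j by lia.
Qed.

Lemma some_cell_shift u y i : some_cell (shift u y) i = some_cell y (i + u).
Proof. by apply: eq_existsb => a; rewrite cell_at_shift. Qed.

Lemma some_cell_at y i a : cell_at y i a -> some_cell y i.
Proof. by move=> h; apply/existsP; exists a. Qed.

Lemma rank_lt (a : cell) : Z.of_nat (enum_rank a) < Z.of_nat nrun.
Proof.
have h : (enum_rank a < #|cell|)%N by exact: ltn_ord.
by rewrite /nrun; move: h; move: #|cell| (nat_of_ord _) => m r; lia.
Qed.

Lemma nbot_bounds (a : cell) : 1 <= nbot a <= Z.of_nat N + 1.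
Proof. by rewrite /nbot; have := ltn_ord a.2; lia. Qed.

Lemma k_gt : Z.of_nat N + 3 < k.
Proof. by rewrite /klen /nrun; lia. Qed.

(** Otherwise a zero of the left codeword falls into the initial run of ones of the right one: its
    last bit if [j - i] exceeds [r + 2], its zero at offset [r + 2] if not. *)
Lemma cell_at_le y i j a b : cell_at y i a -> cell_at y j b -> i <= j < i + k -> i = j.
Proof.
move=> /cell_atP ha /cell_atP hb ij; pose r := Z.of_nat nrun.
have kE : k = 2 * r + 4 by rewrite /r /klen; lia.
have ra := rank_lt a; rewrite -/r in ra.
have zero z : codebit a z = false -> 0 <= z < k -> 0 <= z + i - j < r + 2 -> False.
  move=> az hz hzj; have := ha z hz; rewrite az.
  have := hb (z + i - j); rewrite (_ : j + (z + i - j) = i + z); last lia.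
  by move=> -> //; [rewrite /codebit; case: Z.ltb_spec; rewrite -/r; lia | lia].
case: (Z.eq_dec i j) => // ne.
case: (Z_lt_ge_dec (r + 2) (j - i)) => h.
  case: (zero (k - 1)); try lia.
  by rewrite /codebit -/r; case: Z.ltb_spec => ?; case: Z.eqb_spec => ? //; lia.
case: (zero (r + 2)); try lia.
by rewrite /codebit -/r; case: Z.ltb_spec => ?; case: Z.eqb_spec => ? //; lia.
Qed.

Lemma cell_at_pos y i j a b : cell_at y i a -> cell_at y j b -> Z.abs (i - j) < k -> i = j.
Proof.
move=> ha hb ij; case: (Z_le_gt_dec i j) => h; first by apply: cell_at_le ha hb _; lia.
by apply/esym/(cell_at_le hb ha); lia.
Qed.

Lemma cell_at_inj y i a b : cell_at y i a -> cell_at y i b -> a = b.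
Proof.
move=> /cell_atP ha /cell_atP hb; have ra := rank_lt a; have rb := rank_lt b.
pose z := Z.of_nat nrun + 3 + Z.of_nat (enum_rank a).
have hz : 0 <= z < k by rewrite /z /klen; lia.
have := ha z hz; rewrite hb // /codebit /z.
case: Z.ltb_spec => ?; first lia.
case: Z.eqb_spec => [h _|_]; last by rewrite Z.eqb_refl.
by move/Z.add_reg_l/Nat2Z.inj/val_inj/enum_rank_inj: h.
Qed.

Lemma locateP y o a : cell_at y (- Z.of_nat o) a -> forall ho : (o < klen)%N,
  locate y = Some (Ordinal ho, a).
Proof.
move=> h ho; rewrite /locate; case: pickP => [[o' a'] /= h'|/(_ (Ordinal ho, a))]; last by rewrite h.
have E : - Z.of_nat o' = - Z.of_nat o by apply: cell_at_pos h' h _; have := ltn_ord o'; lia.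
congr (Some (_, _)); first by apply: val_inj => /=; lia.
by rewrite E in h'; apply: cell_at_inj h' h.
Qed.

Section At.
Variables (y : conf S) (i o : Z) (a : cell).
Hypotheses (h : cell_at y i a) (ho : 0 <= o < k).

Let locate_at : exists2 o' : 'I_klen, locate (shift (i + o) y) = Some (o', a) & Z.of_nat o' = o.
Proof.
have ho' : (Z.to_nat o < klen)%N by lia.
exists (Ordinal ho'); last by rewrite /=; lia.
by apply: locateP; rewrite cell_at_shift (_ : - _ + (i + o) = i) //; lia.
Qed.

Lemma fwdE : fwd (shift (i + o) y) =
  if o =? 0 then if some_cell y (i + k) then k else 1
  else if o <? nbot a then 1
  else if o =? nbot a then if some_cell y (i - k) then 1 - o - k else - o
  else 0.
Proof.
have [o' lE oE] := locate_at; rewrite /fwd lE /fwd_at oE !some_cell_shift.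
have -> : - o - k + (i + o) = i - k by lia.
by case: Z.eqb_spec => // ->; rewrite Z.add_0_r (Z.add_comm k).
Qed.

Lemma bwdE : bwd (shift (i + o) y) =
  if o =? 0 then if some_cell y (i - k) then - k else nbot a
  else if o =? 1 then
    if [pick e | cell_at y (i + k) e] is Some e then k - 1 + nbot e else - 1
  else if o <=? nbot a then - 1
  else 0.
Proof.
have [o' lE oE] := locate_at; rewrite /bwd lE /bwd_at oE !some_cell_shift.
case: Z.eqb_spec => [->|_]; first by rewrite Z.add_0_r (_ : - k + i = i - k) //; lia.
case: Z.eqb_spec => // ->; congr (if _ is Some _ then _ else _).
by apply: eq_pick => e; rewrite cell_at_shift (_ : k - 1 + (i + 1) = i + k) //; lia.
Qed.

Lemma letterE : letter (shift (i + o) y) = a.1 (inord (Z.to_nat o)).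
Proof. by have [o' lE oE] := locate_at; rewrite /letter lE -oE Nat2Z.id. Qed.

End At.

Lemma pick_cell y i a : cell_at y i a -> [pick e | cell_at y i e] = Some a.
Proof.
by move=> h; case: pickP => [e he|/(_ a)]; [rewrite (cell_at_inj he h) | rewrite h].
Qed.

Lemma pick_no_cell y i : some_cell y i = false -> [pick e | cell_at y i e] = None.
Proof. by move=> h; case: pickP => // e he; case/existsP: h; exists e. Qed.

Lemma locateNone y : locate y = None -> fwd y = 0 /\ bwd y = 0.
Proof. by rewrite /fwd /bwd => ->. Qed.

Lemma locate_ind (P : conf S -> Prop) :
  (forall y, locate y = None -> P y) ->
  (forall y i o a, cell_at y i a -> 0 <= o < k -> P (shift (i + o) y)) ->
  forall y, P y.
Proof.
move=> P0 P1 y; case E : (locate y) => [[o a]|]; last exact: P0.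
have h : cell_at y (- Z.of_nat o) a by move: E; rewrite /locate; case: pickP => // -[o1 a1] /= hx [<- <-].
rewrite -[y]shift0 (_ : 0 = - Z.of_nat o + Z.of_nat o); last lia.
by apply: P1 h _; have := ltn_ord o; lia.
Qed.

(** Every kind of move lands at an offset whose backward rule undoes it, with the neighbour tests at
    the two places confirming each other. Idle offsets and places outside cells are fixed by
    both. *)
Lemma fwdK y : bwd (shift (fwd y) y) = - fwd y.
Proof.
elim/locate_ind: y => [y /locateNone[-> E]|y i o a h ho]; first by rewrite shift0 E.
have kg := k_gt; have ba := nbot_bounds a.
rewrite shiftD (fwdE h ho).
case: Z.eqb_spec => [->|o0].
  rewrite Z.add_0_r; case: ifP => [/existsP[e he]|hn].
    rewrite -(Z.add_0_r (i + k)) (bwdE he); last lia.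
  rewrite [LHS]/=.
    by rewrite (_ : i + k - k = i) ?(some_cell_at h) //; lia.
  by rewrite (bwdE h) ?pick_no_cell //; lia.
case: Z.ltb_spec => [ob|bo].
  rewrite -Z.add_assoc (bwdE h); last lia.
  case: Z.eqb_spec => ?; first lia; case: Z.eqb_spec => ?; first lia.
  by case: Z.leb_spec => ?; lia.
case: Z.eqb_spec => [oE|ob]; last first.
  rewrite Z.add_0_r (bwdE h ho); case: Z.eqb_spec => ?; first lia; case: Z.eqb_spec => ?; first lia.
  by case: Z.leb_spec => ?; lia.
case: ifP => [/existsP[e he]|hn].
  rewrite (_ : i + o + (1 - o - k) = i - k + 1); last lia.
  rewrite (bwdE he); last lia.
  rewrite [LHS]/=.
  by rewrite (_ : i - k + k = i) ?(pick_cell h) //; lia.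
rewrite (_ : i + o + - o = i + 0); last lia.
by rewrite (bwdE h) ?[LHS]/= ?hn; lia.
Qed.

Lemma bwdK y : fwd (shift (bwd y) y) = - bwd y.
Proof.
elim/locate_ind: y => [y /locateNone[E ->]|y i o a h ho]; first by rewrite shift0 E.
have kg := k_gt; have ba := nbot_bounds a.
rewrite shiftD (bwdE h ho).
case: Z.eqb_spec => [->|o0].
  rewrite Z.add_0_r; case: ifP => [/existsP[e he]|hn].
    rewrite -Z.add_opp_r in he; rewrite -(Z.add_0_r (i + - k)) (fwdE he); last lia.
    rewrite [LHS]/=.
    by rewrite (_ : i + - k + k = i) ?(some_cell_at h) ?Z.opp_involutive //; lia.
  rewrite (fwdE h); last lia.
  by case: Z.eqb_spec => ?; [lia | rewrite Z.ltb_irrefl Z.eqb_refl hn].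
case: Z.eqb_spec => [->|o1].
  case E : [pick e | cell_at y (i + k) e] => [e|]; last first.
    rewrite (_ : i + 1 + -1 = i + 0) ?(fwdE h) ?[LHS]/=; try lia.
    by case: ifP => // /existsP[e he]; move: E; rewrite (pick_cell he).
  have he : cell_at y (i + k) e by move: E; case: pickP => // x hx [<-].
  have be := nbot_bounds e.
  rewrite (_ : i + 1 + (k - 1 + nbot e) = i + k + nbot e); last lia.
  rewrite (fwdE he); last lia.
  case: Z.eqb_spec => ?; [lia | rewrite Z.ltb_irrefl Z.eqb_refl].
  by rewrite (_ : i + k - k = i) ?(some_cell_at h) //; lia.
case: Z.leb_spec => [ob|bo].
  rewrite -Z.add_assoc (fwdE h); last lia.
  by case: Z.eqb_spec => ?; first lia; case: Z.ltb_spec => ?; lia.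
rewrite Z.add_0_r (fwdE h ho); case: Z.eqb_spec => ?; first lia.
by case: Z.ltb_spec => ?; first lia; case: Z.eqb_spec => ?; lia.
Qed.

(** The inspected codewords start within [2 * k] of the head and have length [k]. *)
Definition radius : nat := (3 * klen)%N.

Lemma cell_at_local y y' i a : agree radius y y' -> - (2 * k) <= i <= 2 * k ->
  cell_at y i a = cell_at y' i a.
Proof.
move=> yy hi; apply: eq_forallb => j; rewrite yy //.
by have := ltn_ord j; rewrite /radius; lia.
Qed.

Lemma some_cell_local y y' i : agree radius y y' -> - (2 * k) <= i <= 2 * k ->
  some_cell y i = some_cell y' i.
Proof. by move=> yy hi; apply: eq_existsb => a; apply: cell_at_local yy hi. Qed.

Lemma locate_local y y' : agree radius y y' -> locate y = locate y'.
Proof.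
move=> yy; apply: eq_pick => -[o a] /=; apply: cell_at_local yy _.
by have := ltn_ord o; lia.
Qed.

Lemma fwd_local y y' : agree radius y y' -> fwd y = fwd y'.
Proof.
move=> yy; rewrite /fwd (locate_local yy); case: (locate y') => // -[o a].
have := ltn_ord o => ho.
by rewrite /fwd_at /= !(some_cell_local yy) //; lia.
Qed.

Lemma bwd_local y y' : agree radius y y' -> bwd y = bwd y'.
Proof.
move=> yy; rewrite /bwd (locate_local yy); case: (locate y') => // -[o a].
have kg := k_gt; rewrite /bwd_at (some_cell_local yy); last lia.
rewrite (_ : [pick e | cell_at y (k - 1) e] = [pick e | cell_at y' (k - 1) e]) //.
by apply: eq_pick => e; apply: cell_at_local yy _; lia.
Qed.

Lemma letter_local y y' : agree radius y y' -> letter y = letter y'.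
Proof. by move=> yy; rewrite /letter (locate_local yy). Qed.


(** * A finite belt carrying a periodic point *)

Section Window.
Variables (s0 : S) (z : conf T) (L Q e0 : Z).
Hypotheses (s01 : s0 <> s1) (L1 : 1 <= L) (Qb : L + 1 <= Q <= (Z.of_nat N + 1) * (L + 1)).
Hypotheses (zper : shift (L + 1 + Q) z = z) (e0b : 0 <= e0 <= L).
Local Notation l := (L + 1).

(* Rounding spreads the Q bottom letters evenly over the l cells; cell i gets num i of them. *)
Let beta (i : Z) : Z := i * Q / l.
Let num (i : Z) : Z := beta (i + 1) - beta i.

(** By [Qb], the increment [Q] lies between [l] and [(N + 1) * l], and division by [l] is
    monotone. *)
Let num_bounds i : 1 <= num i <= Z.of_nat N + 1.
Proof.
have h1 : (i * Q + 1 * l) / l <= (i + 1) * Q / l by apply: Z.div_le_mono; lia.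
have h2 : (i + 1) * Q / l <= (i * Q + (Z.of_nat N + 1) * l) / l by apply: Z.div_le_mono; lia.
by rewrite !Z.div_add in h1 h2; rewrite /num /beta; lia.
Qed.

Let beta0 : beta 0 = 0.
Proof. by rewrite /beta Z.div_0_l; lia. Qed.

Let betal : beta l = Q.
Proof. by rewrite /beta Z.mul_comm Z.div_mul; lia. Qed.

(* Position along the belt of the letter o of cell i. *)
Let idx (i o : Z) : Z := if o =? 0 then i else l + Q - beta (i + 1) + o - 1.

Let idx0 i : idx i 0 = i. Proof. by []. Qed.

Let idx_bot i o : 1 <= o -> idx i o = l + Q - beta (i + 1) + o - 1.
Proof. by rewrite /idx; case: Z.eqb_spec => ?; lia. Qed.

(** The shift by [e0] makes a head on the top track of cell [e0] read [z] from its origin. *)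
Let belt_cell (i : Z) : cell :=
  ([ffun o : 'I_N.+2 => z (idx i (Z.of_nat o) - e0)], inord (Z.to_nat (num i - 1))).

Let nbot_belt i : nbot (belt_cell i) = num i.
Proof. have nb := num_bounds i; rewrite /nbot /belt_cell [_.2]/=.
rewrite inordK; move: (num i) nb => n; lia. Qed.

Definition belt_conf : conf S := fun j =>
  if (0 <=? j) && (j <? l * k) && codebit (belt_cell (j / k)) (j mod k) then s1 else s0.

Variable y : conf S.
Hypothesis yE : forall j, - k <= j < (l + 1) * k -> y j = belt_conf j.

Let belt_cell_at i : 0 <= i <= L -> cell_at y (i * k) (belt_cell i).
Proof.
move=> hi; apply/cell_atP => j hj; have kg := k_gt.
have b1 : 0 <= i * k by nia.
have b2 : i * k + j < l * k by nia.
rewrite yE; last lia.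
rewrite /belt_conf; case: Z.leb_spec => ?; last lia; case: Z.ltb_spec => ?; last lia.
rewrite /= (_ : (i * k + j) / k = i) 1?(_ : (i * k + j) mod k = j).
- by case: ifP => _; [exact: eqxx | apply/eqP].
- by rewrite Z.add_comm Z.mod_add ?Z.mod_small; lia.
- by rewrite Z.add_comm Z.div_add ?Z.div_small; lia.
Qed.

(** Codewords begin with a one, but [y] is [s0] on a margin of length [k] on both sides of the belt.
    This is what makes the head turn around at the ends. *)
Let no_cell i : i = - k \/ i = l * k -> some_cell y i = false.
Proof.
move=> hi; apply/negbTE/negP => /existsP[a /cell_atP/(_ 0)]; have kg := k_gt.
rewrite Z.add_0_r yE; last by nia.
rewrite /belt_conf; case: Z.leb_spec => ?; case: Z.ltb_spec => ? /=; try nia.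
all: rewrite (introF eqP s01) /codebit; case: Z.ltb_spec => ? //=; try lia.
all: by move=> h; have := h _; lia.
Qed.

(** Invariant of the walk: [u] is the coordinate of the head and [e] its belt position unrolled to
    the integers, [v] counting full turns. *)
Let on_belt (e u : Z) : Prop := exists i o v,
  [/\ 0 <= i <= L, 0 <= o <= num i, e = idx i o + v * (l + Q) & u = i * k + o].

Let on_belt_fwd e u : on_belt e u -> on_belt (e + 1) (u + fwd (shift u y)).
Proof.
move=> [i [o [v [hi ho -> ->]]]]; have kg := k_gt; have nb := num_bounds i.
rewrite (fwdE (belt_cell_at hi)) ?nbot_belt; last lia.
case: Z.eqb_spec => [->|o0].
  case: (Z.eq_dec i L) => iL.
    rewrite no_cell; last by right; lia.
    exists L, 1, v; rewrite iL in nb *; split; try lia.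
    by rewrite ?idx0 ?idx_bot ?betal; lia.
  have hi' : 0 <= i + 1 <= L by lia.
  have := some_cell_at (belt_cell_at hi'); rewrite (_ : (i + 1) * k = i * k + k); last lia.
  move=> ->; exists (i + 1), 0, v; have := num_bounds (i + 1).
  by split; rewrite ?idx0; lia.
case: Z.ltb_spec => ?.
  exists i, (o + 1), v; split; try lia.
  by rewrite !idx_bot; lia.
case: Z.eqb_spec => oE; last lia.
(* The cells from [i] to [L] hold [Q - beta i] bottom letters, so the next position [l + Q - beta i]
   is the first bottom letter of cell [i - 1], or a completed turn when [i = 0]. *)
have iE : idx i o = l + Q - beta i - 1 by rewrite idx_bot; rewrite /num in oE; lia.
case: (Z.eq_dec i 0) => i0.
  rewrite no_cell; last by left; lia.
  exists 0, 0, (v + 1); have := num_bounds 0; rewrite iE i0 beta0.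
  by split; rewrite ?idx0; lia.
have hi' : 0 <= i - 1 <= L by lia.
have := some_cell_at (belt_cell_at hi'); rewrite (_ : (i - 1) * k = i * k - k); last lia.
move=> ->; exists (i - 1), 1, v; have := num_bounds (i - 1).
rewrite iE idx_bot ?Z.sub_add; last lia.
by split; lia.
Qed.

Let on_belt_bwd e u : on_belt e u -> on_belt (e - 1) (u + bwd (shift u y)).
Proof.
move=> [i [o [v [hi ho -> ->]]]]; have kg := k_gt; have nb := num_bounds i.
rewrite (bwdE (belt_cell_at hi)) ?nbot_belt; last lia.
case: Z.eqb_spec => [->|o0].
  case: (Z.eq_dec i 0) => i0.
    rewrite no_cell; last by left; lia.
    exists 0, (num 0), (v - 1); have n0 := num_bounds 0; rewrite i0.
    by split; try lia; rewrite idx0 idx_bot ; [rewrite /num beta0; lia | lia].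
  have hi' : 0 <= i - 1 <= L by lia.
  have := some_cell_at (belt_cell_at hi'); rewrite (_ : (i - 1) * k = i * k - k); last lia.
  move=> ->; exists (i - 1), 0, v; have := num_bounds (i - 1).
  by split; rewrite ?idx0; lia.
case: Z.eqb_spec => [->|o1].
  case: (Z.eq_dec i L) => iL.
    rewrite pick_no_cell; last by apply: no_cell; right; lia.
    exists L, 0, v; rewrite iL in nb *; split; try lia.
    by rewrite ?idx0 ?idx_bot ?betal; lia.
  have hi' : 0 <= i + 1 <= L by lia.
  have := pick_cell (belt_cell_at hi'); rewrite (_ : (i + 1) * k = i * k + k); last lia.
  move=> ->; exists (i + 1), (num (i + 1)), v; have n1 := num_bounds (i + 1).
  rewrite nbot_belt; split; try lia.
  by rewrite !idx_bot; try lia; rewrite /num; lia.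
case: Z.leb_spec => ?; last lia.
exists i, (o - 1), v; split; try lia.
by rewrite !idx_bot; lia.
Qed.

(** Full turns do not matter, since the belt length [l + Q] is a period of [z]. *)
Let letter_belt e u : on_belt e u -> letter (shift u y) = z (e - e0).
Proof.
move=> [i [o [v [hi ho -> ->]]]]; have kg := k_gt; have nb := num_bounds i.
rewrite (letterE (belt_cell_at hi)) /=; last lia.
rewrite ffunE inordK; last lia.
rewrite Z2Nat.id; last lia.
rewrite -(shift_periodZ v _ zper); congr (z _); lia.
Qed.

Let on_belt_walk m e u : on_belt e u -> on_belt (e + m) (u + walk fwd bwd m (shift u y)).
Proof.
elim/Z.peano_ind: m e u => [|m IH|m IH] e u h; first by rewrite !Z.add_0_r.
  rewrite -Z.add_1_r (walkSl fwdK) shiftD.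
  rewrite (_ : e + (m + 1) = e + 1 + m) ?Z.add_assoc; last lia.
  by apply/IH/on_belt_fwd.
rewrite -Z.sub_1_r (walkPl fwdK bwdK) shiftD.
rewrite (_ : e + (m - 1) = e - 1 + m) ?Z.add_assoc; last lia.
by apply/IH/on_belt_bwd.
Qed.

Lemma itinerary_belt : itinerary fwd bwd letter (shift (e0 * k) y) = z.
Proof.
apply: functional_extensionality => i; rewrite /itinerary shiftD.
rewrite (@letter_belt (e0 + i)); first by congr (z _); lia.
apply: on_belt_walk; exists e0, 0, 0; have := num_bounds e0.
by split; rewrite ?idx0; lia.
Qed.

Let walk_top n i : 0 <= i -> i + Z.of_nat n <= L ->
  walk fwd bwd (Z.of_nat n) (shift (i * k) y) = Z.of_nat n * k.
Proof.
elim: n i => [//|n IH] i i0 iL; have kg := k_gt.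
rewrite (_ : Z.of_nat n.+1 = Z.of_nat n + 1); last lia.
have hi : 0 <= i <= L by lia.
have hi' : 0 <= i + 1 <= L by lia.
have F : fwd (shift (i * k) y) = k.
  rewrite -[i * k]Z.add_0_r (fwdE (belt_cell_at hi)) ?Z.eqb_refl; last lia.
  by rewrite (_ : i * k + k = (i + 1) * k) ?(some_cell_at (belt_cell_at hi')) //; lia.
rewrite (walkSl fwdK) F shiftD (_ : i * k + k = (i + 1) * k); last lia.
by rewrite IH; lia.
Qed.

Lemma walk_belt : walk fwd bwd L y = L * k.
Proof.
have := @walk_top (Z.to_nat L) 0; rewrite Z2Nat.id /= ?shift0; last lia.
by apply; lia.
Qed.

Lemma walk_belt_opp : walk fwd bwd (- L) (shift (L * k) y) = - (L * k).
Proof.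
by have := walkD fwdK bwdK (- L) L y; rewrite walk_belt Z.add_opp_diag_l /=; lia.
Qed.

End Window.
End Belt.

(** * The classes coincide *)

Lemma cyl_agree (S : finType) (n : nat) (v : conf S) : exists w : (2 * n + 1).-tuple S,
  forall y, cyl (- Z.of_nat n) w y -> agree n v y.
Proof.
exists [tuple v (- Z.of_nat n + Z.of_nat j) | j < 2 * n + 1] => y yw i hi.
have hj : (Z.to_nat (i + Z.of_nat n) < 2 * n + 1)%N by lia.
have := yw (Ordinal hj); rewrite tnth_mktuple (_ : _ + _ = i) // /=; lia.
Qed.

(** Take the least multiple of [p] that is at least [2 * (L + 1)]. It leaves one bottom letter or
    more per cell and overshoots by less than [p <= K * L]. *)
Lemma period_multiple (K L p : Z) : 1 <= L -> 1 <= p -> p <= K * L ->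
  exists Q j, L + 1 <= Q <= (K + 1) * (L + 1) /\ L + 1 + Q = j * p.
Proof.
move=> L1 p1 pK; pose j := (2 * (L + 1) + p - 1) / p; exists (j * p - (L + 1)), j.
have h := Z.div_mod (2 * (L + 1) + p - 1) p; have := Z.mod_pos_bound (2 * (L + 1) + p - 1) p.
by rewrite -/j in h; nia.
Qed.

Section Window.
Variables (S T : finType) (s1 : S) (t0 : T) (N : nat).

Local Notation klen := (klen T N).

Lemma belt_window (s0 : S) (z : conf T) (p c : Z) :
  s0 <> s1 -> shift p z = z -> 1 <= p -> c <> 0 -> p <= Z.of_nat N * Z.abs c ->
  exists v : conf S, forall y, agree ((Z.abs_nat c + 3) * klen) v y ->
    itinerary (fwd T s1 N) (bwd T s1 N) (letter s1 t0 N) y = z /\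
    walk (fwd T s1 N) (bwd T s1 N) c y = c * Z.of_nat klen.
Proof.
move=> s01 zp p1 c0 pc; pose L := Z.abs c.
have L1 : 1 <= L by rewrite /L; lia.
have [Q [j [Qb qE]]] := period_multiple L1 p1 pc.
have zper : shift (L + 1 + Q) z = z.
  by apply: functional_extensionality => i; rewrite /shift qE (shift_periodZ j i zp).
(* Start at the left end for positive [c] and at the right end for negative [c], so that all [c]
   steps stay on the top track. *)
pose e0 := if 0 <? c then 0 else L.
have e0b : 0 <= e0 <= L by rewrite /e0; case: ifP; lia.
exists (shift (e0 * Z.of_nat klen) (belt_conf s1 N s0 z L Q e0)) => w vw.
pose y := shift (- (e0 * Z.of_nat klen)) w.
have wE : w = shift (e0 * Z.of_nat klen) y by rewrite /y shiftD Z.add_opp_diag_l shift0.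
have yE i : - Z.of_nat klen <= i < (L + 1 + 1) * Z.of_nat klen ->
    y i = belt_conf s1 N s0 z L Q e0 i.
  move=> hi; rewrite /y {1}/shift -vw; first by rewrite /shift; congr (belt_conf _ _ _ _ _ _ _ _); lia.
  (* Seen from either end, the belt with both margins lies within distance [(L + 3) * klen]. *)
  by rewrite Nat2Z.inj_mul Nat2Z.inj_add Zabs2Nat.id_abs -/L; nia.
split; first by rewrite wE; exact: (itinerary_belt t0 s01 L1 Qb zper e0b yE).
rewrite wE /e0; case: Z.ltb_spec => hc.
  rewrite Z.mul_0_l shift0 (_ : c = L); last by rewrite /L; lia.
  by exact: (walk_belt s01 L1 yE).
rewrite (_ : c = - L) ?Z.mul_opp_l; last by rewrite /L; lia.
by exact: (walk_belt_opp s01 L1 yE).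
Qed.

End Window.

(** * Transfer of a group from one alphabet to another *)

Section Groups.
Variable G : group.

Lemma gmulgV (a : G) : gmul a (ginv a) = gone G.
Proof.
rewrite -[LHS]gmul1g -{1}(gmulVg (ginv a)) -gmulA (gmulA (ginv a) a).
by rewrite gmulVg gmul1g gmulVg.
Qed.

Lemma gmulg1 (a : G) : gmul a (gone G) = a.
Proof. by rewrite -(gmulVg a) gmulA gmulgV gmul1g. Qed.

Lemma G_plin_bnd (S T : finType) : (1 < #|S|)%N -> (1 < #|T|)%N -> G_plin T G -> G_bnd S G.
Proof.
move=> hS hT [H [[Htfg _ _ Hinv] [phi [phiM phi_inj Hphi]] [alpha [[C Clin] [al0 Hla]]]]].
have [s0 [s1 s01]] := two_letters hS; have [t0 _] := two_letters hT.
have Hphia a : H (phi a) by apply/Hphi; exists a.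
have phi1 : phi (gone G) = id.
  have [g [_ gK _]] := Hinv _ (Hphia (gone G)).
  rewrite -gK -[in RHS](gmul1g (gone G)) phiM; apply: functional_extensionality => x /=.
  by have /= -> := congr1 (fun f => f (phi (gone G) x)) gK.
have /(_ _)/constructive_indefinite_description cex a : exists c, is_cocycle (phi a) c.
  by have [] := Htfg _ (Hphia a).
pose c a := proj1_sig (cex a); have cP a : is_cocycle (phi a) (c a) := proj2_sig (cex a).
(* From [n <= |m| + C|m| + C] and [|m| >= 1] one gets [p <= 2n + 1 <= (4C + 3)|m|], which is at most
   [N|m|]. *)
pose N := (3 * (2 * C + 1))%N.
pose E := sim (fwd T s1 N) (bwd T s1 N) (letter s1 t0 N).
pose e := sim_cocycle (fwd T s1 N) (bwd T s1 N) (letter s1 t0 N).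
pose Psi a := E (c a).
have PsiM a b : Psi (gmul a b) = Psi a \o Psi b.
  rewrite /Psi -(sim_comp (letter s1 t0 N) (@fwdK S T s1 N) (@bwdK S T s1 N) (cP a) (cP b)); congr E.
  apply: cocycle_uniq hT (cP _) _; rewrite phiM; exact: cocycle_comp (cP a) (cP b).
have Psi1 : Psi (gone G) = id.
  rewrite /Psi (_ : c _ = fun=> 0); first exact: sim_id.
  by apply: cocycle_uniq hT (cP _) _; rewrite phi1; exact: cocycle_id.
have PsiC a : is_cocycle (Psi a) (e (c a)).
  apply: (sim_is_cocycle (@fwd_local S T s1 N) (@bwd_local S T s1 N) (@letter_local S T s1 t0 N)).
  exact: (cP a).1.
have PsiV a : Psi (ginv a) \o Psi a = id by rewrite -PsiM gmulVg.
have PsiV' a : Psi a \o Psi (ginv a) = id by rewrite -PsiM gmulgV.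
pose B := (3 * klen T N)%N.
have window a : a <> gone G -> exists (n : nat) (w : (2 * n + 1).-tuple S) (m : Z),
    [/\ (1 <= n)%N, forall x, cyl (- Z.of_nat n) w x -> e (c a) x = m,
        m <> 0 & (n <= Z.abs_nat m + B)%N].
  move=> a1; have pa1 : phi a <> id by rewrite -phi1 => /phi_inj.
  have [n [z [p [n1 /andP[p1 pn] zp nc]]]] := Hla _ (Hphia a) pa1 _ (cP a).
  (* Here [alpha 0 = 0] excludes a zero displacement, because [n >= 1]. *)
  set m := c a z in nc; have m0 : m <> 0 by move=> m0; move: nc; rewrite m0 al0; lia.
  have pm : Z.of_nat p <= Z.of_nat N * Z.abs m.
    have := Clin (Z.abs_nat m); rewrite /N; move: (alpha _) nc => al nc; nia.
  have [v vP] := belt_window t0 s01 zp ltac:(lia) m0 pm.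
  exists ((Z.abs_nat m + 3) * klen T N)%N.
  have [w wP] := cyl_agree ((Z.abs_nat m + 3) * klen T N)%N v.
  have k1 : (1 <= klen T N)%N by rewrite /klen; lia.
  (* The window radius exceeds the displacement [|m| * klen] by exactly [3 * klen = B],
     independently of [a]. *)
  exists w, (m * Z.of_nat (klen T N)); split; try by rewrite /B; nia.
  by move=> y /wP/vP[iy my]; rewrite /e /sim_cocycle iy.
exists (fun f => exists a, Psi a = f); split.
- split=> [f [a <-]||f g [a <-] [b <-]|f [a <-]].
  + split; last by exists (e (c a)).
    exists (Psi (ginv a)); split=> //; split=> //.
    by split; exact: cocycle_cont_map (PsiC _).
  + by exists (gone G).
  + by exists (gmul a b).
  + by exists (Psi (ginv a)); split=> //; exists (ginv a).
- exists Psi; split=> // a b ab.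
  (* If [gmul a (ginv b)] were nontrivial, its image would have nonzero displacement on a cylinder,
     yet that image is the identity, whose only cocycle is zero. *)
  case: (classic (gmul a (ginv b) = gone G)) => [h|/window[n [w [m [_ wm m0 _]]]]].
    by rewrite -[a]gmulg1 -(gmulVg b) gmulA h gmul1g.
  case: m0; pose y : conf S := fun i => nth s0 w (Z.to_nat (i + Z.of_nat n)).
  rewrite -(wm y).
    suff -> : e (c (gmul a (ginv b))) = fun=> 0 by [].
    apply: cocycle_uniq hS (PsiC _) _; rewrite PsiM ab PsiV'; exact: cocycle_id.
  by move=> j; rewrite /y (tnth_nth s0); congr (nth s0 w _); lia.
(* The value at 0 is forced by the definition of look-ahead and costs nothing, as the displacements
   found are nonzero. *)
exists (fun n => if n is 0%N then 0%N else B); split; first by exists B; case=> [|n].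
split=> // g [a <-] ga c' c'P.
have /window[n [w [m [n1 wm m0 nm]]]] : a <> gone G by move=> a1; case: ga; rewrite a1.
exists n, w, m; split=> //; split.
  by rewrite (cocycle_uniq hS c'P (PsiC a)).
by case E0 : (Z.abs_nat m) nm => [|q]; first lia.
Qed.

End Groups.

(** Repeating [w] with period [2n + 1] gives a periodic point inside the cylinder of [w]. *)
Lemma lookahead_plookahead (S : finType) (H : (conf S -> conf S) -> Prop) alpha :
  lookahead H alpha -> plookahead H alpha.
Proof.
move=> [a0 h]; split=> // g Hg g1 c cP; have [n [w [m [n1 [wm nm]]]]] := h g Hg g1 c cP.
pose p := Z.of_nat (2 * n + 1).
have p0 i : (Z.to_nat ((i + Z.of_nat n) mod p) < 2 * n + 1)%N.
  by have := Z.mod_pos_bound (i + Z.of_nat n) p; rewrite /p; lia.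
exists n, (fun i => tnth w (Ordinal (p0 i))), (2 * n + 1)%N; split=> //; first by lia.
  apply: functional_extensionality => i; congr (tnth w _); apply: val_inj => /=.
  by rewrite -/p (_ : i + p + Z.of_nat n = i + Z.of_nat n + 1 * p) ?Z.mod_add //; lia.
rewrite wm // => j; congr (tnth w _); apply: val_inj => /=.
have := ltn_ord j; rewrite (_ : - Z.of_nat n + Z.of_nat j + Z.of_nat n = Z.of_nat j); last lia.
by move=> jn; rewrite Z.mod_small ?Nat2Z.id // /p; lia.
Qed.

Lemma bounded_linear alpha : bounded_fn alpha -> linear_fn alpha.
Proof. by move=> [B hB]; exists B => n; have := hB n; nia. Qed.

Lemma GClassW (S : finType) (LA LA' : ((conf S -> conf S) -> Prop) -> (nat -> nat) -> Prop)
    (P P' : (nat -> nat) -> Prop) (G : group) :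
  (forall H alpha, LA H alpha -> LA' H alpha) -> (forall alpha, P alpha -> P' alpha) ->
  GClass LA P G -> GClass LA' P' G.
Proof.
move=> hLA hP [H [h1 h2 [alpha [h3 h4]]]]; exists H; split=> //.
by exists alpha; split; [exact: hP | exact: hLA].
Qed.

Local Open Scope nat_scope.

Theorem mainTheorem4 (S : finType) (hS : 1 < #|S|) (G : group) :
  (G_bnd S G <-> G_pbnd S G) /\
  (G_bnd S G <-> G_lin S G) /\
  (G_bnd S G <-> G_plin S G) /\
  (G_bnd S G <-> G_bnd_all G) /\
  (G_bnd S G <-> G_pbnd_all G) /\
  (G_bnd S G <-> G_lin_all G) /\
  (G_bnd S G <-> G_plin_all G).
Proof.
have bp T : G_bnd T G -> G_pbnd T G by apply: GClassW => //; exact: lookahead_plookahead.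
have bl T : G_bnd T G -> G_lin T G by apply: GClassW => //; exact: bounded_linear.
have ll T : G_lin T G -> G_plin T G by apply: GClassW => //; exact: lookahead_plookahead.
have pl T : G_pbnd T G -> G_plin T G by apply: GClassW => //; exact: bounded_linear.
(* This closes the cycle of inclusions, from the weakest condition over any alphabet to the
   strongest over [S]. *)
have pb (T : finType) : 1 < #|T| -> G_plin T G -> G_bnd S G by exact: G_plin_bnd.
split; first by split=> [/bp|/pl/(pb _ hS)].
split; first by split=> [/bl|/ll/(pb _ hS)].
split; first by split=> [/bl/ll|/(pb _ hS)].
split; first by split=> [h|[T [hT /bl/ll/(pb _ hT)]] //]; exists S.
split; first by split=> [/bp h|[T [hT /pl/(pb _ hT)]] //]; exists S.
split; first by split=> [/bl h|[T [hT /ll/(pb _ hT)]] //]; exists S.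
by split=> [/bl/ll h|[T [hT /(pb _ hT)]] //]; exists S.
Qed.
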